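(* Let $\Gamma$ be the (first) Grigorchuk group. Then $\operatorname{asdim} \Gamma = \infty$.
   Context: The first Grigorchuk group $\Gamma$: Let $\{0,1\}^*$ be the set of finite words in the letters $0,1$ (the vertex set of the infinite rooted binary tree). Define bijections $a,b,c,d$ of $\{0,1\}^*$ (automorphisms of the rooted binary tree), all fixing the empty word, recursively by, for every word $w$, $$a(0w)=1w,\quad a(1w)=0w,$$ $$b(0w)=0\,a(w),\quad b(1w)=1\,c(w),$$ $$c(0w)=0\,a(w),\quad c(1w)=1\,d(w),$$ $$d(0w)=0w,\quad d(1w)=1\,b(w).$$ Then $\Gamma=\langle a,b,c,d\rangle$ is the group of bijections of $\{0,1\}^*$ generated by $a,b,c,d$ under composition. Asymptotic dimension: Let $(X,d)$ be a metric space. For nonempty subsets $U,V \subseteq X$ put $d(U,V)=\inf\{d(u,v): u\in U, v\in V\}$. A family $\mathcal{V}$ of subsets of $X$ is $R$-disjoint if $d(U,V)\geq R$ for all $U,V\in\mathcal{V}$ with $U\neq V$; it is $S$-bounded if $\operatorname{diam} V\leq S$ for all $V\in\mathcal{V}$. For an integer $n \geq 0$, one says $\operatorname{asdim} X\leq n$ if for each $R>0$ there are an $S>0$ and $R$-disjoint, $S$-bounded families $\mathcal{U}_0,\mathcal{U}_1,\ldots,\mathcal{U}_n$ of subsets of $X$ such that $\mathcal{U}_0\cup\cdots\cup\mathcal{U}_n$ is a cover of $X$. One writes $\operatorname{asdim} X=\infty$ if $\operatorname{asdim} X\leq n$ holds for no integer $n\geq 0$. For a finitely generated group $G$, $\operatorname{asdim}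 G$ denotes the asymptotic dimension of $G$ equipped with the word metric associated to a finite generating set; this does not depend on the choice of the finite generating set. *)

(* Defs.v *)
From HB Require Import structures.
From mathcomp Require Import all_boot all_order all_algebra.
From mathcomp Require Import all_classical all_reals all_analysis.

Set Implicit Arguments.
Unset Strict Implicit.
Unset Printing Implicit Defensive.

Import Order.TTheory GRing.Theory Num.Theory.
Local Open Scope classical_set_scope.
Local Open Scope ring_scope.

(** * Asymptotic dimension *)

(* Distance between sets and diameter are extended reals, so that empty
   members of a family are harmless: the infimum over the empty set is +oo
   and the supremum is -oo. *)
Definition set_dist (R : realType) (X : metricType R) (U V : set X) : \bar R :=
  ereal_inf [set (mdist u v)%:E | u in U & v in V].

Definition diam (R : realType) (X : metricType R) (V : set X) : \bar R :=
  ereal_sup [set (mdist u v)%:E | u in V & v in V].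

Definition R_disjoint (R : realType) (X : metricType R) (r : R)
    (F : set (set X)) : Prop :=
  forall U V, F U -> F V -> U <> V -> (r%:E <= set_dist U V)%E.

Definition S_bounded (R : realType) (X : metricType R) (s : R)
    (F : set (set X)) : Prop :=
  forall V, F V -> (diam V <= s%:E)%E.

Definition asdim_le (R : realType) (X : metricType R) (n : nat) : Prop :=
  forall r : R, 0 < r ->
  exists2 s : R, 0 < s &
  exists U : 'I_n.+1 -> set (set X),
    [/\ forall i, R_disjoint r (U i),
        forall i, S_bounded s (U i)
      & \bigcup_i \bigcup_(V in U i) V = [set: X]].

Definition asdim_infinite (R : realType) (X : metricType R) : Prop :=
  forall n : nat, ~ asdim_le X n.

(** * Generated subgroups and word metrics *)

Definition generated (G : groupType) (A : set G) : set G :=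
  smallest (fun H : set G => group_closed (mem H)) A.

Lemma generated_closed (G : groupType) (A : set G) :
  group_closed (mem (generated A)).
Proof.
split=> [|x y]; rewrite !inE.
  by move=> H [[H1 _] _]; rewrite -inE.
move=> gx gy H HA; have [[_ HV] _] := HA.
by rewrite -inE; apply: HV; rewrite inE; [exact: gx|exact: gy].
Qed.

Definition generates (G : groupType) (S : seq G) : Prop :=
  generated [set` S] = [set: G].

(* a word of length n in the letters of S and their inverses, with value g *)
Definition is_word (G : groupType) (S : seq G) (g : G) (n : nat) : Prop :=
  exists w : seq G, [/\ size w = n,
    {in w, forall x, x \in S \/ (x^-1)%g \in S} & (\prod_(x <- w) x)%g = g].

Section WordLength.
Variables (G : groupType) (S : seq G).

Lemma is_word1 : is_word S 1%g 0.
Proof. by exists [::]; rewrite big_nil. Qed.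

Lemma is_wordM g h m n :
  is_word S g m -> is_word S h n -> is_word S (g * h)%g (m + n).
Proof.
move=> [u [<- uS <-]] [v [<- vS <-]]; exists (u ++ v); split.
- by rewrite size_cat.
- by move=> x; rewrite mem_cat => /orP[/uS|/vS].
- by rewrite big_cat.
Qed.

Lemma is_wordV g n : is_word S g n -> is_word S (g^-1)%g n.
Proof.
move=> [u [<- uS <-]]; exists (rev (map (fun x : G => x^-1)%g u)); split.
- by rewrite size_rev size_map.
- move=> x; rewrite mem_rev => /mapP[y /uS yS ->]; rewrite invgK.
  by case: yS; [right|left].
- elim: u {uS} => [|x u IHu]; first by rewrite !big_nil invg1.
  by rewrite /= rev_cons -cats1 big_cat big_seq1 IHu big_cons invgM.
Qed.

Lemma generates_word : generates S -> forall g, exists n, is_word S g n.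
Proof.
move=> genS g; have : generated [set` S] g by rewrite genS.
apply: (_ : generated [set` S] `<=` [set h | exists n, is_word S h n]).
apply: smallest_sub => [|x xS].
  split=> [|x y]; rewrite !inE /=; first by exists 0%N; exact: is_word1.
  by move=> [m xm] [n yn]; exists (m + n)%N; apply/is_wordM/is_wordV.
exists 1%N, [:: x]; split=> //; last by rewrite big_seq1.
by move=> y; rewrite inE => /eqP ->; left.
Qed.

Hypothesis genS : generates S.

Let word_ex g : exists n, `[< is_word S g n >].
Proof. by have [n gn] := generates_word genS g; exists n; apply/asboolP. Qed.

Definition word_length (g : G) : nat := ex_minn (word_ex g).

Lemma word_lengthP g : is_word S g (word_length g).
Proof. by rewrite /word_length; case: ex_minnP => n /asboolP. Qed.

Lemma word_length_le g n : is_word S g n -> (word_length g <= n)%N.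
Proof.
by rewrite /word_length; case: ex_minnP => m _ min_m /asboolP; exact: min_m.
Qed.

Lemma word_length1 : word_length 1%g = 0%N.
Proof. by apply/eqP; rewrite -leqn0; apply/word_length_le/is_word1. Qed.

Lemma word_length_eq0 g : word_length g = 0%N -> g = 1%g.
Proof.
move=> g0; have := word_lengthP g; rewrite g0 => -[w [/size0nil -> _ <-]].
by rewrite big_nil.
Qed.

Lemma word_lengthV g : word_length (g^-1)%g = word_length g.
Proof.
apply/eqP; rewrite eqn_leq; apply/andP; split.
  exact/word_length_le/is_wordV/word_lengthP.
by rewrite -{1}[g]invgK; exact/word_length_le/is_wordV/word_lengthP.
Qed.

Lemma word_lengthM g h :
  (word_length (g * h)%g <= word_length g + word_length h)%N.
Proof. by apply/word_length_le/is_wordM; exact: word_lengthP. Qed.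

End WordLength.

(* G equipped with the word metric d(g, h) = |g^-1 h| of a finite generating
   set S. The alias carries R and S because the instances below depend on
   them. *)
Definition word_metric (R : realType) (G : groupType) (S : seq G)
  (genS : generates S) : Type := G.

Section WordMetric.
Variables (R : realType) (G : groupType) (S : seq G) (genS : generates S).

Definition word_dist (g h : G) : R := (word_length genS (g^-1 * h)%g)%:R.

Lemma word_dist_xx g : word_dist g g = 0.
Proof. by rewrite /word_dist mulVg word_length1. Qed.

Lemma word_dist_positivity g h : word_dist g h = 0 -> g = h.
Proof.
move=> /eqP; rewrite /word_dist pnatr_eq0 => /eqP /word_length_eq0 gh.
by rewrite -[h](mulVKg g) gh mulg1.
Qed.

Lemma word_dist_sym g h : word_dist g h = word_dist h g.
Proof. by rewrite /word_dist -word_lengthV invgM invgK. Qed.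

Lemma word_dist_triangle h g k :
  word_dist g k <= word_dist g h + word_dist h k.
Proof.
rewrite /word_dist -natrD ler_nat.
have -> : (g^-1 * k = (g^-1 * h) * (h^-1 * k))%g by rewrite -mulgA mulVKg.
exact: word_lengthM.
Qed.

HB.instance Definition _ := Choice.on (word_metric R genS).
HB.instance Definition _ := isMetric.Build R (word_metric R genS)
  word_dist_xx word_dist_positivity word_dist_sym word_dist_triangle.

Lemma mdist_word (g h : word_metric R genS) : mdist g h = word_dist g h.
Proof. by []. Qed.
End WordMetric.

(** * Bijections of a type *)

Record bijection (T : Type) := Bijection {
  bij_fun :> T -> T;
  bij_inv : T -> T;
  bij_funK : cancel bij_fun bij_inv;
  bij_invK : cancel bij_inv bij_fun }.

Section BijectionGroup.
Variable T : Type.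
Implicit Types f g : bijection T.

Lemma bijectionP f g : f =1 g -> f = g.
Proof.
case: f g => [f f' fK f'K] [g g' gK g'K] /= /funext fg; subst g.
have f'g' : f' = g' by apply/funext => x; rewrite -{1}[x]g'K fK.
by subst g'; congr Bijection; exact: Prop_irrelevance.
Qed.

Definition bijection_one : bijection T :=
  @Bijection T id id (fun=> erefl) (fun=> erefl).
Definition bijection_inv f : bijection T :=
  Bijection (@bij_invK _ f) (@bij_funK _ f).
(* (f * g) x = f (g x) *)
Definition bijection_mul f g : bijection T :=
  Bijection (can_comp (@bij_funK _ f) (@bij_funK _ g))
            (can_comp (@bij_invK _ g) (@bij_invK _ f)).

HB.instance Definition _ := gen_eqMixin (bijection T).
HB.instance Definition _ := gen_choiceMixin (bijection T).

Let mulA : associative bijection_mul.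
Proof. by move=> f g h; exact: bijectionP. Qed.
Let mul1 : left_id bijection_one bijection_mul.
Proof. by move=> f; exact: bijectionP. Qed.
Let mulr1 : right_id bijection_one bijection_mul.
Proof. by move=> f; exact: bijectionP. Qed.
Let mulV : left_inverse bijection_one bijection_inv bijection_mul.
Proof. by move=> f; apply: bijectionP => x /=; rewrite bij_funK. Qed.
Let mulrV : right_inverse bijection_one bijection_inv bijection_mul.
Proof. by move=> f; apply: bijectionP => x /=; rewrite bij_invK. Qed.

HB.instance Definition _ :=
  isGroup.Build (bijection T) mulA mul1 mulr1 mulV mulrV.
End BijectionGroup.

(** * The first Grigorchuk group *)

(* Finite words over {0, 1}, the letters 0 and 1 being false and true. *)
Definition word : Type := seq bool.

Definition fun_a (u : word) : word :=
  if u is x :: w then ~~ x :: w else [::].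

Fixpoint fun_b (u : word) : word :=
  match u with
  | [::] => [::]
  | false :: w => false :: fun_a w
  | true :: w => true :: fun_c w
  end
with fun_c (u : word) : word :=
  match u with
  | [::] => [::]
  | false :: w => false :: fun_a w
  | true :: w => true :: fun_d w
  end
with fun_d (u : word) : word :=
  match u with
  | [::] => [::]
  | false :: w => false :: w
  | true :: w => true :: fun_b w
  end.

Lemma fun_aK : involutive fun_a.
Proof. by case=> [|x w] //=; rewrite negbK. Qed.

Lemma fun_bcdK u :
  [/\ fun_b (fun_b u) = u, fun_c (fun_c u) = u & fun_d (fun_d u) = u].
Proof. by elim: u => [|[] w [IHb IHc IHd]] /=; rewrite ?IHb ?IHc ?IHd ?fun_aK. Qed.

Lemma fun_bK : involutive fun_b. Proof. by move=> u; have [] := fun_bcdK u. Qed.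
Lemma fun_cK : involutive fun_c. Proof. by move=> u; have [] := fun_bcdK u. Qed.
Lemma fun_dK : involutive fun_d. Proof. by move=> u; have [] := fun_bcdK u. Qed.

Definition bij_a : bijection word := Bijection fun_aK fun_aK.
Definition bij_b : bijection word := Bijection fun_bK fun_bK.
Definition bij_c : bijection word := Bijection fun_cK fun_cK.
Definition bij_d : bijection word := Bijection fun_dK fun_dK.

Definition grigorchuk_gens : seq (bijection word) :=
  [:: bij_a; bij_b; bij_c; bij_d].

Definition grigorchuk_set : set (bijection word) :=
  generated [set` grigorchuk_gens].

Definition grigorchuk : Type := {x : bijection word | x \in grigorchuk_set}.

HB.instance Definition _ := SubChoice.on grigorchuk.
HB.instance Definition _ :=
  SubChoice_isSubGroup.Build (bijection word) (mem grigorchuk_set) grigorchuk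
    (generated_closed _).

Lemma grigorchuk_gen_in x : x \in grigorchuk_gens -> x \in grigorchuk_set.
Proof. by move=> xS; rewrite inE; exact: sub_gen_smallest. Qed.

Lemma bij_a_in : bij_a \in grigorchuk_set.
Proof. by apply: grigorchuk_gen_in; rewrite !inE eqxx ?orbT. Qed.
Lemma bij_b_in : bij_b \in grigorchuk_set.
Proof. by apply: grigorchuk_gen_in; rewrite !inE eqxx ?orbT. Qed.
Lemma bij_c_in : bij_c \in grigorchuk_set.
Proof. by apply: grigorchuk_gen_in; rewrite !inE eqxx ?orbT. Qed.
Lemma bij_d_in : bij_d \in grigorchuk_set.
Proof. by apply: grigorchuk_gen_in; rewrite !inE eqxx ?orbT. Qed.

Definition grig_a : grigorchuk := Sub bij_a bij_a_in.
Definition grig_b : grigorchuk := Sub bij_b bij_b_in.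
Definition grig_c : grigorchuk := Sub bij_c bij_c_in.
Definition grig_d : grigorchuk := Sub bij_d bij_d_in.

Lemma grigorchuk_generates : generates [:: grig_a; grig_b; grig_c; grig_d].
Proof.
apply/seteqP; split=> // -[g gG] _ H [[H1 HV] SH].
pose K : set (bijection word) := [set x | exists2 h : grigorchuk, H h & val h = x].
have gK : K g.
  have : generated [set` grigorchuk_gens] g by rewrite -inE.
  apply; split; last first.
    move=> x /=; rewrite !inE => xS.
    case/or4P: xS => /eqP ->;
      [exists grig_a|exists grig_b|exists grig_c|exists grig_d] => //;
      by apply: SH; rewrite /= !inE eqxx ?orbT.
  split=> [|x y]; rewrite !inE.
    by exists 1%g; rewrite ?val1// -inE.
  move=> [x' Hx <-] [y' Hy <-]; exists (x' / y')%g; last by rewrite gmulfF.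
  by rewrite -inE; apply: HV; rewrite inE.
by case: gK => h Hh hg; rewrite (_ : exist _ _ _ = h)//; apply/val_inj.
Qed.

(* Main.v *)
Require Import Defs.
From mathcomp Require Import all_boot all_order all_algebra.
From mathcomp Require Import all_classical all_reals all_analysis.

(** Asymptotic dimension is bounded below by large grids. Suppose that, for a
fixed L and arbitrarily large s, the grid [0, m]^(n+1) maps to X so that points
whose coordinates differ by at most 1 go to points at distance at most L, while
opposite faces go more than s apart. Then asdim X > n ([asdim_grid]): given
n+1 disjoint bounded families covering X, let the i-th of them cut the grid
between its two i-th faces; no member of a family is wide enough to join two
opposite faces, and no small cube of the grid can meet all n+1 cuts, because the
points of such a cube would belong to no family. The contrary is asserted by a
discrete form of the Poincare-Miranda theorem ([poincare_miranda]), a parity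
count modulo 2: the grid carries a chain made of small simplices whose boundary
lies in the faces, and the cochain du_0 cup ... cup du_n of the cuts u_i is the
coboundary of u_0 (du_1 cup ... cup du_n), so by induction on the dimension it
takes the value 1 on this chain.

The Grigorchuk group contains such grids of every dimension because it is a
branch group. Let K be the normal closure of (ab)^2. If k is in K, then the
automorphism which acts as k below 0 and trivially below 1 belongs to K again
([K_branch]); iterating along the rightmost ray of the tree, n independent
copies of K act on disjoint subtrees and embed K^n into K ([K_product]). This
embedding is Lipschitz in each coordinate, because balls are finite, and it does
not shrink distances in any coordinate, because passing to sections does not
increase the word length ([len_sections]). Finally K contains
paths with bounded steps and arbitrarily distant ends ([K_path]): the group is
infinite, and every element is within distance 10 of K ([K_dense]). The product
of n+1 copies of such a path is the required grid. *)

Set Implicit Arguments.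
Unset Strict Implicit.
Unset Printing Implicit Defensive.

Local Open Scope nat_scope.

(** * Chains modulo 2 in a grid *)

Section Chains.

(** Chains with coefficients in F_2 are lists of simplices, simplices are lists
of vertices, and a cochain is a boolean function [phi] of simplices; its value
on a chain is a parity, which makes cancellation of simplices implicit. *)
Notation "\parity_ ( s <- r ) F" := (\big[addb/false]_(s <- r) F)
  (at level 36, s at level 0, r at level 50, F at level 36).

Definition vertex := seq nat.
Implicit Types (x y v : vertex) (s f : seq vertex) (phi : seq vertex -> bool).

(** The only face of a point is the empty simplex, so that this is the augmented
complex. *)
Fixpoint faces s : seq (seq vertex) :=
  if s is v :: s' then s' :: [seq v :: f | f <- faces s'] else [::].

Definition lift t s : seq vertex := [seq t :: v | v <- s].

(** The standard triangulation of s x [t, t+1]: its simplices run along s at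
height t up to some vertex, step to height t+1 above it, and continue. *)
Fixpoint prism t s : seq (seq vertex) :=
  if s is v :: s' then
    ((t :: v) :: lift t.+1 s) :: [seq (t :: v) :: p | p <- prism t s']
  else [::].

(** The fundamental chain of [0, m]^k. *)
Fixpoint cube m k : seq (seq vertex) :=
  if k is k'.+1 then
    [seq p | t <- iota 0 m, p <- [seq p | s <- cube m k', p <- prism t s]]
  else [:: [:: [::]]].

(** The cup product of the coboundaries of the 0-cochains [us]. *)
Fixpoint cup (us : seq (vertex -> bool)) s : bool :=
  match us, s with
  | [::], [:: _] => true
  | u :: us', v :: (w :: _) as s' => (u v (+) u w) && cup us' s'
  | _, _ => false
  end.

Lemma big_faces_cons v s phi :
  \parity_(f <- faces (v :: s)) phi f =
  phi s (+) \parity_(f <- faces s) phi (v :: f).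
Proof. by rewrite big_cons big_map. Qed.

Lemma big_prism_cons t v s phi :
  \parity_(p <- prism t (v :: s)) phi p =
  phi ((t :: v) :: lift t.+1 (v :: s)) (+)
    \parity_(p <- prism t s) phi ((t :: v) :: p).
Proof. by rewrite big_cons big_map. Qed.

Lemma big_faces_lift t s phi :
  \parity_(f <- faces (lift t s)) phi f = \parity_(f <- faces s) phi (lift t f).
Proof.
elim: s phi => [|v s IHs] phi; first by rewrite !big_nil.
by rewrite !big_faces_cons IHs.
Qed.

(** The boundary of the prism consists of its top, its bottom and the prism on
the boundary. A face obtained by deleting one of two vertices above the same
vertex of s is shared by two consecutive simplices and cancels, except at the
ends, where it is the top or the bottom. *)
Lemma prism_boundary t s phi :
  \parity_(p <- prism t s) \parity_(f <- faces p) phi f =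
  phi (lift t.+1 s) (+) phi (lift t s) (+)
    \parity_(f <- faces s) \parity_(p <- prism t f) phi p.
Proof.
elim: s phi => [|v s IHs] phi; first by rewrite !big_nil /= addbb.
rewrite big_prism_cons 2!big_faces_cons big_faces_lift big_faces_cons.
under [X in _ (+) X = _]eq_bigr do rewrite big_faces_cons.
under [X in _ = _ (+) (_ (+) X)]eq_bigr do rewrite big_prism_cons.
rewrite !big_split /= IHs.
have cancel (A B C D E F : bool) :
  A (+) (B (+) C) (+) (D (+) (B (+) E (+) F)) = A (+) E (+) (D (+) (C (+) F)).
  by case: A B C D E F => [] [] [] [] [] [].
exact: cancel.
Qed.

(** Stacking prisms, the intermediate levels cancel. *)
Lemma prism_boundary_sum m (c : seq (seq vertex)) phi :
  \parity_(p <- [seq p | t <- iota 0 m, p <- [seq p | s <- c, p <- prism t s]])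
     \parity_(f <- faces p) phi f =
  \parity_(s <- c) (phi (lift m s) (+) phi (lift 0 s)) (+)
  \parity_(t <- iota 0 m)
    \parity_(s <- c) \parity_(f <- faces s) \parity_(p <- prism t f) phi p.
Proof.
rewrite big_allpairs_dep /=; under eq_bigr do rewrite big_allpairs_dep /=.
under eq_bigr do under eq_bigr do rewrite prism_boundary.
under eq_bigr do rewrite big_split /=.
rewrite big_split /=; congr addb.
rewrite exchange_big /=; apply: eq_bigr => s _.
elim: m => [|m IHm]; first by rewrite big_nil addbb.
rewrite -addn1 iotaD big_cat big_seq1 /= IHm add0n addn1.
by case: (phi (lift m s)); case: (phi (lift m.+1 s)); case: (phi (lift 0 s)).
Qed.

Lemma faces_faces s phi :
  \parity_(f <- faces s) \parity_(e <- faces f) phi e = false.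
Proof.
elim: s phi => [|v s IHs] phi; first by rewrite big_nil.
rewrite big_faces_cons.
under [X in _ (+) X]eq_bigr do rewrite big_faces_cons.
by rewrite big_split /= IHs addbF addbb.
Qed.

(** The cochain u cup (du_1 cup ... cup du_j). *)
Definition cup_primitive (u : vertex -> bool) us s : bool :=
  if s is v :: _ then u v && cup us s else false.

(** Leibniz rule: the coboundary of u cup c is du cup c when c is a cocycle. *)
Lemma cup_primitiveE u us s :
  (forall s', \parity_(f <- faces s') cup us f = false) ->
  cup (u :: us) s = \parity_(f <- faces s) cup_primitive u us f.
Proof.
case: s => [|v [|w s]] cocycle; rewrite ?big_nil// ?big_seq1//.
rewrite big_faces_cons /cup_primitive -big_distrr/=.
have := cocycle (v :: w :: s); rewrite big_faces_cons.
case: (\big[_/_]_(_ <- _) _); case: (cup us (w :: s)) => //= _.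
all: by case: (u v); case: (u w).
Qed.

Lemma cup_cocycle us s : \parity_(f <- faces s) cup us f = false.
Proof.
elim: us s => [|u us IHus] s; last first.
  by under eq_bigr do rewrite cup_primitiveE//; rewrite faces_faces.
case: s => [|v [|w [|z s]]]; rewrite /= ?big_cons ?big_nil//.
rewrite big1_seq// => f /andP[_].
by rewrite -map_comp => /mapP[g _ ->].
Qed.

Section Grid.
Variable m : nat.

Definition grid (k : nat) x : bool := (size x == k) && all (leq^~ m) x.

Definition near_coords x y := forall i, nth 0 x i <= (nth 0 y i).+1.

Lemma mem_prism t s p x : p \in prism t s -> x \in p ->
  exists2 v, v \in s & x = t :: v \/ x = t.+1 :: v.
Proof.
elim: s p => //= w s IHs p; rewrite inE => /predU1P[->|/mapP[q qs ->]];
  rewrite inE => /predU1P[->|].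
- by exists w; [rewrite mem_head|left].
- move=> /(@mapP _ _ _ (w :: s))[v vs ->].
  by exists v => //; right.
- by exists w; [rewrite mem_head|left].
- by move=> /(IHs _ qs)[v vs xv]; exists v; rewrite // inE vs orbT.
Qed.

Lemma cubeS k p : p \in cube m k.+1 ->
  exists t s, [/\ t < m, s \in cube m k & p \in prism t s].
Proof.
move=> /allpairsPdep[t [q [tm /allpairsPdep[s [r [sk rs ->]]] ->]]].
by exists t, s; split=> //; move: tm; rewrite mem_iota.
Qed.

Lemma cube_grid k s x : s \in cube m k -> x \in s -> grid k x.
Proof.
elim: k s x => [|k IHk] s x.
  by rewrite inE => /eqP ->; rewrite inE => /eqP ->.
move=> /cubeS[t [q [tm qk sq]]] /(mem_prism sq)[v /(IHk _ _ qk) /andP[sv vm]].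
by case=> ->; rewrite /grid /= eqSS sv vm ?tm ?(ltnW tm).
Qed.

Lemma cube_near k s x y : s \in cube m k -> x \in s -> y \in s ->
  near_coords x y.
Proof.
elim: k s x y => [|k IHk] s x y.
  by rewrite inE => /eqP -> /[!inE] /eqP -> /eqP -> i; rewrite nth_nil.
move=> /cubeS[t [q [tm qk sq]]] /(mem_prism sq)[v vq xv] /(mem_prism sq)[w wq yw].
have nvw := IHk _ _ _ qk vq wq.
by case: xv => ->; case: yw => -> [|i] //=; exact: ltnW.
Qed.

(** The empty simplex is counted as lying in a face, because it is a term of the
augmented boundary of the 0-dimensional cube. *)
Definition in_side (k : nat) s : Prop :=
  {in s, forall x, grid k x} /\
  (s = [::] \/ exists i c, [/\ i < k, c = 0 \/ c = m & {in s, forall x, nth 0 x i = c}]).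

Lemma in_side_prism k t s p :
  t < m -> in_side k s -> p \in prism t s -> in_side k.+1 p.
Proof.
move=> tm [sk sidek] ps; split=> [x /(mem_prism ps)[v /sk /andP[sv vm]]|].
  by case=> ->; rewrite /grid /= eqSS sv vm ?tm ?(ltnW tm).
case: sidek => [s0|[i [c [ik cm sc]]]]; first by rewrite s0 in ps.
right; exists i.+1, c; split=> // x /(mem_prism ps)[v /sc <-].
by case=> ->.
Qed.

Lemma in_side_lift k t s : t = 0 \/ t = m -> {in s, forall x, grid k x} ->
  in_side k.+1 (lift t s).
Proof.
move=> tm sk; split=> [x /mapP[v /sk/andP[sv vm] ->]|].
  by rewrite /grid /= eqSS sv vm andbT; case: tm => ->; rewrite ?leqnn.
by right; exists 0, t; split=> // x /mapP[v _ ->].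
Qed.

(** The boundary of the cube is carried by its faces, tested against the
cochains which vanish there. *)
Lemma cube_boundary k phi : (forall f, in_side k f -> phi f = false) ->
  \parity_(s <- cube m k) \parity_(f <- faces s) phi f = false.
Proof.
elim: k phi => [|k IHk] phi phi0.
  by rewrite /= !big_seq1 phi0//; split=> //; left.
rewrite /= prism_boundary_sum big1_seq ?addFb => [|s /andP[_ sk]].
  rewrite big1_seq// => t /andP[_]; rewrite mem_iota => /= tm.
  apply: (IHk (fun f => \parity_(p <- prism t f) phi p)) => f fk.
  by rewrite big1_seq// => p /andP[_ pf]; exact/phi0/(in_side_prism tm fk).
by rewrite !phi0//; apply: in_side_lift => [|x]; [left| |right|];
  move=> // /(cube_grid sk).
Qed.

Lemma cup_nonconstant us s i : cup us s -> i < size us ->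
  exists x y, [/\ x \in s, y \in s,
    nth (fun=> false) us i x = false & nth (fun=> false) us i y = true].
Proof.
elim: us s i => [|u us IHus] s i; first by rewrite ltn0.
case: s => [|v [|w s]] //= /andP[uvw]; case: i => [_ _|i cups] /=.
  have [vs ws] : v \in [:: v, w & s] /\ w \in [:: v, w & s] by rewrite !inE !eqxx !orbT.
  by case uv: (u v) uvw; case uw: (u w) => // _; [exists w, v|exists v, w].
rewrite ltnS => /(IHus _ _ cups)[x [y [xs ys ux uy]]].
by exists x, y; split; rewrite // inE ?xs ?ys orbT.
Qed.

(** [u] is the indicator of the far side of a wall between the two opposite
faces in direction [i]. *)
Definition separates (k i : nat) (u : vertex -> bool) :=
  forall x, grid k x ->
  (nth 0 x i = 0 -> u x = false) /\ (nth 0 x i = m -> u x = true).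

Lemma cup_lift t us s :
  cup us (lift t s) = cup [seq u \o cons t | u <- us] s.
Proof.
elim: us s => [|u us IHus] [|v [|w s]] //=.
by rewrite -IHus.
Qed.

(** Stokes: du_0 cup ... cup du_k is the coboundary of u_0 cup (du_1 cup ... cup
du_k), which vanishes where u_0 does, hence on the bottom, restricts to the
cochain of the next lower dimension on the top, and vanishes on the other faces,
where one of the remaining u_i is constant. *)
Lemma cube_cup k us : size us = k ->
  (forall i, i < k -> separates k i (nth (fun=> false) us i)) ->
  \parity_(s <- cube m k) cup us s = true.
Proof.
elim: k us => [|k IHk] [|u us] // => [_ _|[usk] sep]; first by rewrite big_seq1.
under eq_bigr do rewrite (cup_primitiveE _ _ (cup_cocycle _)).
have grid_cons t x : t <= m -> grid k x -> grid k.+1 (t :: x).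
  by move=> tm /andP[sx xm]; rewrite /grid /= eqSS sx tm xm.
rewrite /cube -/cube prism_boundary_sum [X in _ (+) X]big1_seq => [|t].
  rewrite addbF -[RHS](IHk [seq u' \o cons m | u' <- us]) ?size_map//; last first.
    move=> i ik x xk; rewrite (nth_map (fun=> false)) ?usk//=.
    exact: (sep i.+1 ik (m :: x) (grid_cons _ _ (leqnn m) xk)).
  apply: eq_big_seq => s sk; rewrite -cup_lift.
  have end_value t : t <= m -> t = 0 \/ t = m ->
      cup_primitive u us (lift t s) = (t == m) && cup us (lift t s).
    case: s sk => [|v s] sk tm tE.
      by case: (us) => [|? ?] /=; rewrite ?andbF.
    have vk := grid_cons _ _ tm (cube_grid sk (mem_head _ _)).
    have [u0 um] := sep 0 isT _ vk.
    rewrite /= in u0 um *; congr andb.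
    by case: eqP => [/um//|tNm]; apply: u0; case: tE.
  (* For m = 0 top and bottom coincide, but then u_0 would be both 0 and 1. *)
  rewrite !end_value; [|by []|by left|by []|by right].
  rewrite eqxx; case: eqP => [m0|_] /=; last by rewrite addbF.
  have [] := sep 0 isT (0 :: nseq k 0) => [|-> // /(_ m0)//].
  by rewrite /grid /= size_nseq eqxx all_nseq leq0n orbT.
rewrite mem_iota => /= tm.
apply: (cube_boundary (phi := fun f => \parity_(p <- prism t f) cup_primitive u us p)).
move=> f [fk sidef]; rewrite big1_seq// => p /andP[_ pf].
suff cup0 : cup us p = false by case: (p) cup0 => //= v p' ->; rewrite andbF.
case: sidef => [f0|[i [c [ik cm fc]]]]; first by rewrite f0 in pf.
have side x : x \in p -> grid k.+1 x /\ nth 0 x i.+1 = c.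
  move=> /(mem_prism pf)[v vf]; have := grid_cons _ _ _ (fk _ vf).
  by move=> gv [] ->; rewrite /= fc// gv// ltnW.
apply/negP => /(@cup_nonconstant _ _ i); rewrite usk => /(_ ik)[x [y [xp yp ux uy]]].
have [/(sep i.+1 ik)[x0 xm] xc] := side x xp.
have [/(sep i.+1 ik)[y0 ym] yc] := side y yp.
case: cm => cm; first by rewrite /= in y0; rewrite y0 ?yc in uy.
by rewrite /= in xm; rewrite xm ?xc in ux.
Qed.

(** Walls separating the opposite faces of a cube in every direction have a
common small simplex. *)
Lemma poincare_miranda k (u : nat -> vertex -> bool) :
  (forall i, i < k -> separates k i (u i)) ->
  exists s, [/\ {in s, forall x, grid k x},
    {in s &, forall x y, near_coords x y}, s <> [::] &
    forall i, i < k ->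
      exists x y, [/\ x \in s, y \in s, u i x = false & u i y = true]].
Proof.
move=> sep; have nth_u i : i < k -> nth (fun=> false) (mkseq u k) i = u i.
  by move=> ik; rewrite nth_mkseq.
have : has (cup (mkseq u k)) (cube m k).
  apply: contraT => /hasPn nocup.
  have := @cube_cup k (mkseq u k); rewrite big1_seq => [|s /andP[_ /nocup/negPf]//].
  by rewrite size_mkseq => /(_ erefl); apply=> i ik; rewrite nth_u//; exact: sep.
move=> /hasP[s sk cups]; exists s; split.
- by move=> x; exact: cube_grid sk.
- by move=> x y; exact: cube_near sk.
- by move=> s0; move: cups; rewrite s0; case: mkseq.
- move=> i ik; have := cup_nonconstant (i := i) cups.
  by rewrite size_mkseq nth_u//; apply.
Qed.

End Grid.

End Chains.

(** * Grids bound the asymptotic dimension from below *)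

Section AsdimGrid.
Import Order.TTheory GRing.Theory Num.Theory.
Local Open Scope ring_scope.

(** The i-th wall surrounds the members of the i-th family which come close to
the face x_i = 0. A small simplex crossing this wall contains no point of the
i-th family: a member through such a point is within distance L of the whole
simplex, which therefore lies on one side of the wall. *)
Lemma asdim_grid (R : realType) (X : metricType R) (n : nat) (L : R) :
  0 <= L ->
  (forall s : R, exists (m : nat) (F : vertex -> X),
    (forall x y, grid m n.+1 x -> grid m n.+1 y ->
       near_coords x y -> near_coords y x -> mdist (F x) (F y) <= L) /\
    (forall i x y, (i < n.+1)%N -> grid m n.+1 x -> grid m n.+1 y ->
       nth 0%N x i = 0%N -> nth 0%N y i = m -> s < mdist (F x) (F y))) ->
  ~ asdim_le X n.
Proof.
move=> L0 grids /(_ (L + L + 1)) [|s s0 [U [disjU bndU covU]]].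
  by rewrite ltr_wpDl// addr_ge0.
have [m [F [Fnear Ffar]]] := grids (L + s + L).
pose start i (V : set X) := exists y z, [/\ grid m n.+1 y, nth 0%N y i = 0%N,
  V z & mdist (F y) z <= L].
(* [low i] is the near side of the i-th wall. *)
pose low i x := nth 0%N x i = 0%N \/
  exists V z, [/\ U (inord i) V, start i V, V z & mdist (F x) z <= L].
have bnd i V z z' : U i V -> V z -> V z' -> mdist z z' <= s.
  move=> UV Vz Vz'; have := bndU i V UV; rewrite /diam => sup.
  rewrite -lee_fin; apply: le_trans sup; apply: ereal_sup_ubound.
  by exists z => //; exists z'.
have disj i V V' z z' : U i V -> U i V' -> V z -> V' z' ->
    mdist z z' <= L + L -> V = V'.
  move=> UV UV' Vz Vz' zz'; apply: contrapT => VV'.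
  have := disjU i V V' UV UV' VV'; apply/negP; rewrite -ltNge.
  apply: (@le_lt_trans _ _ (mdist z z')%:E); last first.
    by rewrite lte_fin (le_lt_trans zz')// ltrDl.
  by apply: ereal_inf_lbound; exists z => //; exists z'.
have sep i : (i < n.+1)%N -> separates m n.+1 i (fun x => ~~ `[< low i x >]).
  move=> ik x xk; split=> [x0|xm].
    by apply/negbTE/negPn/asboolP; left.
  apply/asboolP; case=> [x0|].
    have := Ffar i x x ik xk xk x0 xm; rewrite mdistxx; apply/negP.
    by rewrite -leNgt !addr_ge0// ltW.
  move=> [V [z [UV [y [z' [yk y0 Vz' yz']]] Vz xz]]].
  have := Ffar i y x ik yk xk y0 xm; apply/negP; rewrite -leNgt.
  apply: (le_trans (metric_triangle _ z _)); rewrite lerD//; last first.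
    by rewrite metric_sym.
  by apply: (le_trans (metric_triangle _ z' _)); rewrite lerD// (bnd (inord i) V).
have [[|p t] [tk tnear // _ tsep]] :=
  @poincare_miranda m n.+1 (fun i x => ~~ `[< low i x >]) sep.
have tL x y : x \in p :: t -> y \in p :: t -> mdist (F x) (F y) <= L.
  by move=> xt yt; apply: Fnear; rewrite ?tk//; exact: tnear.
have pt := mem_head p t.
have : [set: X]%classic (F p) by [].
rewrite -covU => -[i _ [V UV VFp]].
have [x [y [xt yt]]] := tsep i (ltn_ord i).
move=> /negbFE/asboolP lowx /asboolP; apply; right.
exists V, (F p); split; rewrite ?inord_val ?tL//.
case: lowx => [x0|[V' [z [UV' startV' V'z xz]]]].
  by exists x, (F p); split; rewrite ?tk ?tL.
rewrite inord_val in UV'; rewrite (disj i V V' (F p) z)//.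
by apply: (le_trans (metric_triangle _ (F x) _)); rewrite lerD ?tL.
Qed.

End AsdimGrid.

(** * Words and sections in the Grigorchuk group *)

Section Grigorchuk.
Local Open Scope group_scope.
Implicit Types g h k : grigorchuk.

Local Notation a := grig_a.
Local Notation b := grig_b.
Local Notation c := grig_c.
Local Notation d := grig_d.

Lemma grig_eqP g h : val g =1 val h -> g = h.
Proof. by move=> gh; apply/val_inj/bijectionP. Qed.

Lemma grig_valM g h u : val (g * h) u = val g (val h u).
Proof. by rewrite gmulfM. Qed.

Lemma grig_val1 u : val (1 : grigorchuk) u = u.
Proof. by rewrite gmulf1. Qed.

Lemma aa : a * a = 1.
Proof. by apply: grig_eqP => u; rewrite grig_valM grig_val1; exact: fun_aK. Qed.

Lemma bb : b * b = 1.
Proof. by apply: grig_eqP => u; rewrite grig_valM grig_val1; exact: fun_bK. Qed.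

Lemma cc : c * c = 1.
Proof. by apply: grig_eqP => u; rewrite grig_valM grig_val1; exact: fun_cK. Qed.

Lemma dd : d * d = 1.
Proof. by apply: grig_eqP => u; rewrite grig_valM grig_val1; exact: fun_dK. Qed.

Lemma bcd_comp u : [/\ fun_b (fun_c u) = fun_d u, fun_c (fun_d u) = fun_b u
  & fun_d (fun_b u) = fun_c u].
Proof. by elim: u => [|[] u [IHd IHb IHc]] //=; rewrite ?IHd ?IHb ?IHc ?fun_aK. Qed.

Lemma db : d * b = c.
Proof. by apply: grig_eqP => u; rewrite grig_valM; have [_ _] := bcd_comp u. Qed.

Lemma aaK g : a * (a * g) = g. Proof. by rewrite mulgA aa mul1g. Qed.
Lemma bbK g : b * (b * g) = g. Proof. by rewrite mulgA bb mul1g. Qed.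
Lemma ddK g : d * (d * g) = g. Proof. by rewrite mulgA dd mul1g. Qed.

Lemma invol_inv g : g * g = 1 -> g^-1 = g.
Proof. by move=> gg; rewrite -[RHS]mulg1 -(mulgV g) mulgA gg mul1g. Qed.

Lemma db_comm : d * b = b * d.
Proof.
have dbdb : d * b * (d * b) = 1 by rewrite db cc.
by rewrite -[LHS]invol_inv// invgM !invol_inv ?bb ?dd.
Qed.

(** The alphabet is a finite type, which makes balls finite. *)
Definition letter (x : bool * bool) : grigorchuk :=
  match x with
  | (false, false) => a
  | (false, true) => b
  | (true, false) => c
  | (true, true) => d
  end.

Definition word_eval (w : seq (bool * bool)) : grigorchuk := \prod_(x <- w) letter x.

Definition len g : nat := word_length grigorchuk_generates g.

Lemma word_eval_nil : word_eval [::] = 1. Proof. by rewrite /word_eval big_nil. Qed.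
Lemma word_eval_cons x w : word_eval (x :: w) = letter x * word_eval w.
Proof. by rewrite /word_eval big_cons. Qed.

Lemma letter_in x : letter x \in [:: a; b; c; d].
Proof. by case: x => [[] []]; rewrite !inE eqxx ?orbT. Qed.

Lemma letterV x : (letter x)^-1 = letter x.
Proof. by case: x => [[] []]; rewrite invol_inv ?aa ?bb ?cc ?dd. Qed.

Lemma letterP g : g \in [:: a; b; c; d] -> exists x, letter x = g.
Proof.
rewrite !inE => /or4P[]/eqP->;
  by [exists (false, false)|exists (false, true)
     |exists (true, false)|exists (true, true)].
Qed.

Lemma len_word_eval w : len (word_eval w) <= size w.
Proof.
apply: word_length_le; exists (map letter w); split.
- by rewrite size_map.
- by move=> _ /mapP[x _ ->]; left; exact: letter_in.
- by rewrite big_map.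
Qed.

Lemma len_word g : exists2 w, word_eval w = g & size w = len g.
Proof.
rewrite /len; have [w [<- wS <-]] := word_lengthP grigorchuk_generates g.
elim: w wS => [|h w IHw] wS; first by exists [::]; rewrite ?word_eval_nil ?big_nil.
have [w' word_eval' sw'] : exists2 w', word_eval w' = \prod_(x <- w) x & size w' = size w.
  by apply: IHw => x xw; apply: wS; rewrite inE xw orbT.
have [x xh] : exists x, letter x = h.
  case: (wS h (mem_head _ _)) => /letterP[x xh]; exists x => //.
  by rewrite -letterV xh invgK.
by exists (x :: w'); rewrite ?word_eval_cons ?big_cons ?xh ?word_eval' //= sw'.
Qed.

Lemma lenM g h : len (g * h) <= len g + len h.
Proof. exact: word_lengthM. Qed.

Lemma lenV g : len g^-1 = len g.
Proof. exact: word_lengthV. Qed.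

Lemma len1 : len 1 = 0.
Proof. exact: word_length1. Qed.

Lemma len_letter x : len (letter x) <= 1.
Proof. by have := len_word_eval [:: x]; rewrite word_eval_cons word_eval_nil mulg1. Qed.

(** Balls are finite. *)
Lemma len_bounded (f : grigorchuk -> nat) n :
  exists L, forall g, len g <= n -> f g <= L.
Proof.
exists (\max_(w : n.-bseq (bool * bool)%type) f (word_eval w)) => g.
have [w <- <-] := len_word g => wn.
exact: (leq_bigmax (Bseq wn)).
Qed.

Definition pair_action (f0 f1 : word -> word) (u : word) : word :=
  match u with
  | [::] => [::]
  | false :: w => false :: f0 w
  | true :: w => true :: f1 w
  end.

(** [g] fixes the first level of the tree and acts as [g0] below 0 and as [g1]
below 1. *)
Definition sections g g0 g1 : Prop := val g =1 pair_action (val g0) (val g1).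

Lemma sections_inj g h g0 g1 : sections g g0 g1 -> sections h g0 g1 -> g = h.
Proof. by move=> sg sh; apply: grig_eqP => u; rewrite sg sh. Qed.

Lemma sections_fun g g0 g1 h0 h1 :
  sections g g0 g1 -> sections g h0 h1 -> g0 = h0 /\ g1 = h1.
Proof.
move=> sg sh; split; apply: grig_eqP => u.
  by have := sg (false :: u); rewrite sh => -[].
by have := sg (true :: u); rewrite sh => -[].
Qed.

Lemma sections1 : sections 1 1 1.
Proof. by move=> [|[] u]; rewrite !grig_val1/= ?grig_val1. Qed.

Lemma sectionsM g g0 g1 h h0 h1 :
  sections g g0 g1 -> sections h h0 h1 -> sections (g * h) (g0 * h0) (g1 * h1).
Proof. by move=> sg sh [|[] u]; rewrite grig_valM sh /= sg //= grig_valM. Qed.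

Lemma sectionsV g g0 g1 : sections g g0 g1 -> sections g^-1 g0^-1 g1^-1.
Proof.
move=> sg u; set v := pair_action _ _ u.
have -> : u = val g v.
  by rewrite sg /v; case: (u) => [|[] w] //=; rewrite bij_invK.
by rewrite -grig_valM mulVg grig_val1.
Qed.

Lemma sections_b : sections b a c. Proof. by case=> [|[] u]. Qed.
Lemma sections_c : sections c a d. Proof. by case=> [|[] u]. Qed.
Lemma sections_d : sections d 1 b.
Proof. by case=> [|[] u] //=; rewrite grig_val1. Qed.

Lemma sections_swap g g0 g1 : sections g g0 g1 -> sections (a * g * a) g1 g0.
Proof. by move=> sg [|[] u]; rewrite !grig_valM /= sg. Qed.

(** The group is self-replicating: the left sections of b, aba, aca and ada are
a, c, d and b. *)
Lemma sections_lift g : exists g' g1, sections g' g g1.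
Proof.
have [w <- _] := len_word g.
elim: w => [|x w [g' [g1 sg]]].
  by exists 1, 1; rewrite word_eval_nil; exact: sections1.
suff [x' [x1 sx]] : exists x' x1, sections x' (letter x) x1.
  by exists (x' * g'), (x1 * g1); rewrite word_eval_cons; exact: sectionsM.
case: x => [[] []].
- by exists (a * c * a), a; exact/sections_swap/sections_c.
- by exists (a * b * a), a; exact/sections_swap/sections_b.
- by exists (a * d * a), 1; exact/sections_swap/sections_d.
- by exists b, c; exact: sections_b.
Qed.

(** Each letter of a word contributes at most one letter to each section, and
the letter a only swaps the sections. *)
Lemma word_sections w : exists g0 g1, [/\ len g0 <= size w, len g1 <= size w
  & sections (word_eval w) g0 g1 \/ sections (a * word_eval w) g0 g1].
Proof.
elim: w => [|x w [g0 [g1 [l0 l1 sw]]]].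
  by exists 1, 1; rewrite len1 word_eval_nil; split=> //; left; exact: sections1.
rewrite word_eval_cons.
have [xa|[x0 [x1 [lx0 lx1 sx]]]] : letter x = a \/
    exists x0 x1, [/\ len x0 <= 1, len x1 <= 1 & sections (letter x) x0 x1].
  have la := len_letter (false, false); have lb := len_letter (false, true).
  have lc := len_letter (true, false); have ld := len_letter (true, true).
  case: x => [[] []]; [right|right|right|by left].
  - by exists 1, b; rewrite len1; split=> //; exact: sections_d.
  - by exists a, d; split=> //; exact: sections_c.
  - by exists a, c; split=> //; exact: sections_b.
- exists g0, g1; rewrite xa aaK; split; [exact: leqW|exact: leqW|].
  by case: sw; [right|left].
- case: sw => sw.
    exists (x0 * g0), (x1 * g1); split.
    + by rewrite (leq_trans (lenM _ _))//= -add1n leq_add.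
    + by rewrite (leq_trans (lenM _ _))//= -add1n leq_add.
    + by left; exact: sectionsM.
  exists (x1 * g0), (x0 * g1); split.
  + by rewrite (leq_trans (lenM _ _))//= -add1n leq_add.
  + by rewrite (leq_trans (lenM _ _))//= -add1n leq_add.
  + right; have := sectionsM (sections_swap sx) sw.
    by rewrite -!mulgA aaK.
Qed.

Lemma len_sections g g0 g1 : sections g g0 g1 -> len g0 <= len g /\ len g1 <= len g.
Proof.
move=> sg; have [w wg <-] := len_word g.
have [h0 [h1 [l0 l1]]] := word_sections w; rewrite wg => -[] sh.
  by have [-> ->] := sections_fun sg sh.
by have := sh [:: true]; rewrite grig_valM sg.
Qed.

(** * The branching subgroup *)

(** The normal closure of (ab)^2. *)
Inductive K : grigorchuk -> Prop :=
| K1 : K 1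
| KM g h : K g -> K h -> K (g * h)
| KV g : K g -> K g^-1
| K_conj_gen g : K (g * (a * b * a * b) * g^-1).

Lemma K_conj g k : K k -> K (g * k * g^-1).
Proof.
elim=> [|h h' _ IHh _ IHh'|h _ IHh|h].
- by rewrite mulg1 mulgV; exact: K1.
- by have := KM IHh IHh'; rewrite !mulgA mulgVK.
- by have := KV IHh; rewrite !invgM invgK !mulgA.
- by have := K_conj_gen (g * h); rewrite invgM !mulgA.
Qed.

(** (bada)^2 acts as (ab)^2 below 0 and as c^2 = 1 below 1, and it is a product
of two conjugates of (ab)^2. Any conjugate of (ab)^2 is reached by conjugating
it with an element whose left section is the given one. *)
Lemma K_branch k : K k -> exists2 k', K k' & sections k' k 1.
Proof.
elim=> [|g h _ [g' Kg' sg] _ [h' Kh' sh]|g _ [g' Kg' sg]|g].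
- by exists 1; [exact: K1|exact: sections1].
- by exists (g' * h'); [exact: KM|have := sectionsM sg sh; rewrite mulg1].
- by exists g'^-1; [exact: KV|have := sectionsV sg; rewrite invg1].
have [v Kv sv] : exists2 v, K v & sections v (a * b * a * b) 1.
  exists (b * (a * d * a) * (b * (a * d * a))); last first.
    have sv := sectionsM sections_b (sections_swap sections_d).
    by have := sectionsM sv sv; rewrite !mulg1 cc !mulgA.
  have -> : b * (a * d * a) * (b * (a * d * a)) =
     (b * (a * b * a * b) * b^-1) * (a * d * b * (a * b * a * b) * (a * d * b)^-1).
    rewrite !invgM !(invol_inv aa, invol_inv bb, invol_inv dd) -!mulgA.
    by rewrite !(bbK, aaK) (mulgA d b) db_comm -mulgA bbK.
  by apply: KM; exact: K_conj_gen.
have [g' [g1 sg]] := sections_lift g.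
exists (g' * v * g'^-1); first exact: K_conj.
have := sectionsM (sectionsM sg sv) (sectionsV sg).
by rewrite mulg1 mulgV.
Qed.

(** Equality modulo the normal subgroup [K]. *)
Definition congK g h : Prop := K (g * h^-1).

Lemma congK_refl g : congK g g.
Proof. by rewrite /congK mulgV; exact: K1. Qed.

Lemma congK_trans g h k : congK g h -> congK h k -> congK g k.
Proof. by move=> gh hk; have := KM gh hk; rewrite mulgA mulgVK. Qed.

Lemma congK_mull l g h : congK g h -> congK (l * g) (l * h).
Proof. by move=> gh; rewrite /congK invgM mulgA -(mulgA l); exact: K_conj. Qed.

Lemma congK_mulr l g h : congK g h -> congK (g * l) (h * l).
Proof. by rewrite /congK invgM mulgA mulgK. Qed.

Lemma congK_ab : congK (a * b) (b * a).
Proof.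
rewrite /congK invgM (invol_inv aa) (invol_inv bb).
by have := K_conj_gen 1; rewrite invg1 mulg1 mul1g !mulgA.
Qed.

(** (da)^2 = d (ada) has both sections equal to b. *)
Lemma ad4 : (d * a) ^+ 4 = 1.
Proof.
have sda2 : sections (d * a * (d * a)) b b.
  have := sectionsM sections_d (sections_swap sections_d).
  by rewrite mul1g mulg1 !mulgA.
rewrite (expgnA _ 2 2) !expg2; apply: (sections_inj (sectionsM sda2 sda2)).
by rewrite bb; exact: sections1.
Qed.

Lemma congK_push_b l (i : bool) : congK (l * b) (b * l) ->
  congK (l * b ^+ i) (b ^+ i * l).
Proof.
by case: i => //=; rewrite !expg0 mulg1 mul1g => _; exact: congK_refl.
Qed.

(** Modulo [K] the involution b is central, since it commutes with d, and with
a modulo [K]. The other generators a and d span a dihedral group of order 8, so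
the quotient by [K] is finite. *)
Definition normal_form (i e : bool) j := b ^+ i * (a ^+ e * (d * a) ^+ j).

Lemma congK_normal_form g : exists i e j, congK g (normal_form i e j).
Proof.
pose nf h := exists i e j, congK h (normal_form i e j).
have push l h i e i' e' j j' : congK (l * b) (b * l) ->
    l * (a ^+ (e : bool) * (d * a) ^+ j) = a ^+ (e' : bool) * (d * a) ^+ j' ->
    congK h (normal_form i e j) -> congK (l * h) (normal_form i e' j').
  move=> /(congK_push_b i) lb lr hK; apply: congK_trans (congK_mull _ hK) _.
  by rewrite /normal_form -lr mulgA [X in congK _ X]mulgA; exact: congK_mulr.
have nf_a h : nf h -> nf (a * h).
  move=> [i [e [j hK]]]; exists i, (~~ e), j; apply: push hK => //.
    exact: congK_ab.
  by case: e => /=; rewrite ?expg0 ?mul1g ?aaK.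
have nf_b h : nf h -> nf (b * h).
  move=> [i [e [j /(congK_mull b) hK]]]; exists (~~ i), e, j.
  by case: i hK; rewrite /normal_form /= ?expg0 ?mul1g ?bbK.
have nf_d h : nf h -> nf (d * h).
  move=> [i [e [j hK]]]; exists i, (~~ e), (if e then j.+1 else 3 + j).
  apply: push hK => //; first by rewrite db_comm; exact: congK_refl.
  (* (da)^3 is the inverse ad of da, so that d = a (da)^3. *)
  case: e; rewrite !expgb /=; first by rewrite mul1g expgS mulgA.
  rewrite mul1g expgnDr mulgA; congr (_ * _).
  have := ad4; rewrite expgS -mulgA => /(congr1 (fun h => d * h)).
  by rewrite ddK mulg1 => ->.
have [w <- _] := len_word g.
elim: w => [|x w IHw].
  by exists false, false, 0; rewrite word_eval_nil /normal_form !mul1g; exact: congK_refl.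
rewrite word_eval_cons; case: x => [[] []]; [exact: nf_d| |exact: nf_b|exact: nf_a].
by rewrite /= -db -mulgA; exact/nf_d/nf_b.
Qed.

(** The exponent of da matters only modulo 4. *)
Lemma len_normal_form i e j : len (normal_form i e j) <= 10.
Proof.
have lenb (x : bool * bool) (i' : bool) : len (letter x ^+ i') <= 1.
  by case: i'; [exact: len_letter|rewrite len1].
have -> : normal_form i e j = normal_form i e (j %% 4).
  rewrite /normal_form {1}(divn_eq j 4) expgnDr mulnC expgnA ad4.
  by rewrite expg1n mul1g.
have lenda n : len ((d * a) ^+ n) <= n * 2.
  elim: n => [|n IHn]; first by rewrite len1.
  rewrite expgS (leq_trans (lenM _ _))// mulSn leq_add// (leq_trans (lenM _ _))//.
  exact: leq_add (len_letter (true, true)) (len_letter (false, false)).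
rewrite (leq_trans (lenM _ _))// (@leq_trans (1 + (1 + 4 * 2)))// leq_add//.
  exact: (lenb (false, true)).
rewrite (leq_trans (lenM _ _))// leq_add//; first exact: (lenb (false, false)).
rewrite (leq_trans (lenda _))// leq_mul2r /= ltnW// ltn_pmod//.
Qed.

Lemma K_dense g : exists2 k, K k & len (k^-1 * g) <= 10.
Proof.
have [i [e [j gK]]] := congK_normal_form g.
exists (g * (normal_form i e j)^-1) => //.
by rewrite invgM invgK mulgVK len_normal_form.
Qed.

Lemma level_transitive (t : word) :
  exists g, val g (nseq (size t) false) = t.
Proof.
elim: t => [|x t [g gt]]; first by exists 1; rewrite grig_val1.
have [g' [g1 sg]] := sections_lift g.
case: x; last by exists g'; rewrite sg /= gt.
by exists (a * g'); rewrite grig_valM sg /= gt.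
Qed.

(** The group moves the vertex 0^N to each of the 2^N vertices of level N; N
words cannot do so. *)
Lemma len_unbounded n : exists g, n < len g.
Proof.
apply: contrapT => /forallNP short.
(* N is generalized to keep the cardinal from being computed. *)
have [N cardN] : exists N, #|{: n.-bseq (bool * bool)}| = N by eexists.
have onto (t : N.-tuple bool) :
    exists w : n.-bseq (bool * bool), val (word_eval w) (nseq N false) = t.
  have [g gt] := level_transitive t; rewrite size_tuple in gt.
  have [w wg sw] := len_word g.
  have wn : size w <= n by rewrite sw leqNgt; apply/negP; exact: short.
  by exists (Bseq wn); rewrite /= wg.
have [f fP] := choice onto.
have f_inj : injective f by move=> t t' ff; apply/val_inj; rewrite -[LHS]fP ff fP.
by have := leq_card f f_inj; rewrite card_tuple card_bool cardN leqNgt ltn_expl.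
Qed.

(** Along a geodesic of the group, replace each point by an element of [K] at
distance at most 10; the steps become at most 10 + 1 + 10. *)
Lemma K_path n : exists m (k : nat -> grigorchuk),
  [/\ forall j, K (k j), forall j, len ((k j)^-1 * k j.+1) <= 21
    & n < len ((k 0)^-1 * k m)].
Proof.
have [q qP] := choice (fun g => let: ex_intro2 k Kk lk := K_dense g in
  ex_intro (fun k => K k /\ len (k^-1 * g) <= 10) k (conj Kk lk)).
have [g gn] := len_unbounded (n + 20).
have [w wg _] := len_word g.
exists (size w), (fun j => q (word_eval (take j w))); split=> [j|j|].
- by have [] := qP (word_eval (take j w)).
- have step : len ((word_eval (take j w))^-1 * word_eval (take j.+1 w)) <= 1.
    elim: w j {wg} => [|x w IHw] [|j] /=; rewrite ?mulVg ?len1//.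
      by rewrite take0 word_eval_cons !word_eval_nil invg1 mul1g mulg1 len_letter.
    by rewrite !word_eval_cons invgM -mulgA mulKg.
  have [_ lj] := qP (word_eval (take j w)); have [_ lj1] := qP (word_eval (take j.+1 w)).
  set p := word_eval _ in lj step *; set p' := word_eval _ in lj1 step *.
  have -> : (q p)^-1 * q p' = (q p)^-1 * p * (p^-1 * p') * ((q p')^-1 * p')^-1.
    by rewrite invgM invgK !mulgA !mulgK.
  by rewrite (leq_trans (lenM _ _))// lenV (@leq_trans (10 + 1 + 10))// leq_add//
    (leq_trans (lenM _ _))// leq_add.
- rewrite take_size take0 wg word_eval_nil.
  have [_] := qP 1; rewrite mulg1 lenV => l1; have [_ lg] := qP g.
  rewrite -(ltn_add2r 20) (leq_trans gn)//.
  have {1}-> : g = q 1 * ((q 1)^-1 * q g) * ((q g)^-1 * g).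
    by rewrite !mulgA mulgK mulgV mul1g.
  rewrite (leq_trans (lenM _ _))// -[20]/(10 + 10) addnA leq_add//.
  by rewrite (leq_trans (lenM _ _))// addnC leq_add//.
Qed.

Lemma branching_map : exists E : grigorchuk -> grigorchuk,
  forall k, K k -> K (E k) /\ sections (E k) k 1.
Proof.
have branch k : exists k', K k -> K k' /\ sections k' k 1.
  have [Kk|nKk] := pselect (K k); last by exists 1 => /nKk.
  by have [k' Kk' sk] := K_branch Kk; exists k'.
by have [E EP] := choice branch; exists E.
Qed.

(** The embedding of K^n into [K] sends (k_0, ..., k_(n-1)) to the automorphism
acting as k_i below the vertex 1^i 0. *)
Lemma K_product n : exists emb : seq grigorchuk -> grigorchuk,
  (forall B, exists L, forall ks hs, size ks = n -> size hs = n ->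
     {in ks, forall k, K k} -> {in hs, forall h, K h} ->
     (forall i, i < n -> len ((nth 1 ks i)^-1 * nth 1 hs i) <= B) ->
     len ((emb ks)^-1 * emb hs) <= L) /\
  (forall ks hs i, size ks = n -> size hs = n ->
     {in ks, forall k, K k} -> {in hs, forall h, K h} -> i < n ->
     len ((nth 1 ks i)^-1 * nth 1 hs i) <= len ((emb ks)^-1 * emb hs)).
Proof.
have [E EP] := branching_map.
have sE k : K k -> sections (E k) k 1 by move=> /EP[].
have sE' k : K k -> sections (a * E k * a) 1 k by move=> /sE; exact: sections_swap.
pose emb := foldr (fun k g => E k * (a * E g * a)) 1.
have embK ks : {in ks, forall k, K k} -> K (emb ks).
  elim: ks => [|k ks IHks] ksK; first exact: K1.
  have Kk : K k by apply: ksK; exact: mem_head.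
  have /EP[Kemb _] : K (emb ks) by apply: IHks => h hks; apply: ksK; rewrite inE hks orbT.
  have [KEk _] := EP k Kk; apply: KM KEk _.
  by have := K_conj a Kemb; rewrite (invol_inv aa).
have emb_cons k ks : K k -> K (emb ks) -> sections (emb (k :: ks)) k (emb ks).
  move=> Kk Kks; have := sectionsM (sE k Kk) (sE' _ Kks).
  by rewrite mulg1 mul1g.
have emb_diff k ks h hs : K k -> K h -> K (emb ks) -> K (emb hs) ->
    sections ((emb (k :: ks))^-1 * emb (h :: hs)) (k^-1 * h) ((emb ks)^-1 * emb hs).
  by move=> *; apply: sectionsM; [apply: sectionsV|]; exact: emb_cons.
have consK k ks : {in k :: ks, forall h, K h} -> K k /\ {in ks, forall h, K h}.
  move=> ksK; split=> [|h hks]; apply: ksK; rewrite ?mem_head//.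
  by rewrite inE hks orbT.
exists emb; split=> [B|].
  elim: n => [|n [L IHn]].
    by exists 0 => -[|//] [|//] *; rewrite mulVg len1.
  have [L0 L0P] := len_bounded (len \o E) (maxn B L).
  exists (L0 + (1 + L0 + 1)) => -[//|k ks] [//|h hs] [sks] [shs].
  move=> /consK[Kk Kks] /consK[Kh Khs] close.
  have lk := close 0 isT.
  have lks := IHn ks hs sks shs Kks Khs (fun i => close i.+1).
  rewrite /= in lk; set k0 := k^-1 * h in lk *; set k1 := _ * _ in lks.
  have Kk0 : K k0 by apply: KM => //; exact: KV.
  have Kk1 : K k1 by apply: KM; [apply: KV|]; exact: embK.
  have -> : (emb (k :: ks))^-1 * emb (h :: hs) = E k0 * (a * E k1 * a).
    apply: sections_inj (emb_diff _ _ _ _ Kk Kh (embK _ Kks) (embK _ Khs)) _.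
    by have := sectionsM (sE _ Kk0) (sE' _ Kk1); rewrite mulg1 mul1g.
  have la := len_letter (false, false).
  rewrite (leq_trans (lenM _ _))// leq_add//.
    by apply: L0P; rewrite leq_max lk.
  rewrite (leq_trans (lenM _ _))// leq_add// (leq_trans (lenM _ _))// leq_add//.
  by apply: L0P; rewrite leq_max lks orbT.
elim: n => [//|n IHn] [//|k ks] [//|h hs] i [sks] [shs].
move=> /consK[Kk Kks] /consK[Kh Khs].
have [l0 l1] := len_sections (emb_diff _ _ _ _ Kk Kh (embK _ Kks) (embK _ Khs)).
by case: i => [_|i ni] /=; [exact: l0|apply: leq_trans l1; exact: IHn].
Qed.

End Grigorchuk.

(** * Grids in the Grigorchuk group *)

(** Word metrics of different finite generating sets are Lipschitz equivalent. *)
Lemma word_length_lipschitz (G : groupType) (S T : seq G)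
    (genS : generates S) (genT : generates T) :
  exists C, forall g, word_length genS g <= C * word_length genT g.
Proof.
exists (\max_(t <- T) word_length genS t) => g.
have [w [<- wT <-]] := word_lengthP genT g.
have inT t : t \in T -> word_length genS t <= \max_(t <- T) word_length genS t.
  by move=> tT; rewrite (big_rem t)//= leq_maxl.
elim: w wT => [|x w IHw] wT; first by rewrite big_nil word_length1.
rewrite big_cons (leq_trans (word_lengthM _ _ _))//= mulnS leq_add//.
  by case: (wT x (mem_head _ _)) => /inT; rewrite ?word_lengthV.
by apply: IHw => y yw; apply: wT; rewrite inE yw orbT.
Qed.

Import Order.TTheory GRing.Theory Num.Theory.

Theorem mainTheorem2 (R : realType) (S : seq grigorchuk) (genS : generates S) :
  asdim_infinite (word_metric R genS).
Proof.
move=> n.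
have [C CP] := word_length_lipschitz genS grigorchuk_generates.
have [C' CP'] := word_length_lipschitz grigorchuk_generates genS.
have [emb [emb_close emb_far]] := K_product n.+1.
have [L LP] := emb_close 21.
apply: (@asdim_grid _ _ _ (C * L)%:R%R); first exact: ler0n.
move=> s; have [m [k [Kk k_step k_far]]] := K_path (C' * Num.bound s).
exists m, (fun x => emb (map k x)).
have mapK x : {in map k x, forall h, K h} by move=> _ /mapP[j _ ->].
have nth_map_k x i : grid m n.+1 x -> i < n.+1 -> nth 1%g (map k x) i = k (nth 0 x i).
  by move=> /andP[/eqP sx _] ik; rewrite (nth_map 0) ?sx.
have size_k x : grid m n.+1 x -> size (map k x) = n.+1.
  by move=> /andP[/eqP sx _]; rewrite size_map.
split=> [x y xn yn xy yx|i x y ik xn yn x0 ym]; rewrite mdist_word /word_dist.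
  rewrite ler_nat (leq_trans (CP _))// leq_mul2l (LP (map k x) (map k y)) ?orbT ?size_k//.
  move=> i ik; rewrite !nth_map_k//.
  have := xy i; have := yx i; set p := nth 0 x i; set q := nth 0 y i.
  rewrite leq_eqVlt => /predU1P[->//|]; rewrite ltnS => qp.
  rewrite leq_eqVlt => /predU1P[->|]; last first.
    rewrite ltnS => pq; have -> : p = q by apply/eqP; rewrite eqn_leq pq.
    by rewrite mulVg len1.
  by rewrite -lenV invgM invgK.
have dist := emb_far _ _ i (size_k x xn) (size_k y yn) (mapK x) (mapK y) ik.
rewrite !nth_map_k// x0 ym in dist.
have bound_s : (Num.bound s < word_length genS ((emb (map k x))^-1 * emb (map k y))%g)%N.
  have := leq_trans (leq_trans k_far dist) (CP' _).
  by rewrite ltn_mul2l => /andP[].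
have [s0|s0] := leP 0%R s; last by rewrite (lt_le_trans s0).
by rewrite (lt_trans (archi_boundP s0))// ltr_nat.
Qed.
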